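(* Let $(M,\pi)$ be a (real or complex) Poisson manifold that admits a separable symplectic resolution. Then $(M,\pi)$ is symplectic on an open dense subset of $M$.
   Context: Manifolds are Hausdorff and paracompact (possibly with uncountably many connected components). A symplectic manifold is a Poisson manifold whose bivector field is invertible at every point; a Poisson manifold is symplectic on an open subset if its bivector field is invertible at every point of that subset. A symplectic resolution of a real or complex Poisson manifold $(M,\pi)$ of dimension $n$ is a triple $(\Sigma,\Pi_\Sigma,\varphi)$ where $(\Sigma,\Pi_\Sigma)$ is a symplectic manifold of the same dimension $n$ and $\varphi:\Sigma\to M$ is a surjective Poisson morphism, i.e. $\{\varphi^*F,\varphi^*G\}_\Sigma=\varphi^*\{F,G\}_M$ for all local functions $F,G$ on $M$ ($\varphi$ is smooth in the real case, holomorphic in the complex case, and not required to be a submersion). It is separable if $\Sigma$ admits a countable dense subset. *)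

(* Defs.v *)
(* Libraries: MathComp, MathComp-Analysis, and real-closed for the field R[i]. *)
From HB Require Import structures.
From mathcomp Require Import all_boot all_order all_algebra.
From mathcomp Require Import complex.
From mathcomp Require Import all_classical all_reals all_analysis.

Set Implicit Arguments.
Unset Strict Implicit.
Unset Printing Implicit Defensive.

Import Order.TTheory GRing.Theory Num.Theory.
Import numFieldNormedType.Exports.

Local Open Scope classical_set_scope.
Local Open Scope ring_scope.

Definition paracompact (T : topologicalType) : Prop :=
  forall C : set (set T),
    (forall A, C A -> open A) -> \bigcup_(A in C) A = setT ->
  exists D : set (set T),
    [/\ (forall B, D B -> open B),
        \bigcup_(B in D) B = setT,
        (forall B, D B -> exists2 A, C A & B `<=` A) &
        (forall x : T, exists2 W, nbhs x W &
           finite_set [set B | D B /\ B `&` W !=set0])].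

Definition separable_space (T : topologicalType) : Prop :=
  exists2 D : set T, countable D & dense D.

(* A notion of admissible map defined on an open subset of K^m; maps are total
   functions of which only the restriction to the given open set matters. *)
Definition regularity (K : numFieldType) : Type :=
  forall (m : nat) (V : normedModType K),
    set 'rV[K]_m -> ('rV[K]_m -> V) -> Prop.

Fixpoint class_C (K : numFieldType) (m : nat) (V : normedModType K) (k : nat)
    (U : set 'rV[K]_m) (f : 'rV[K]_m -> V) : Prop :=
  if k is k'.+1 then
    (forall x, U x -> differentiable f x) /\
    (forall i : 'I_m, class_C k' U (fun x => 'D_(delta_mx 0 i) f x))
  else forall x, U x -> {for x, continuous f}.

Definition smooth_on (K : numFieldType) : regularity K :=
  fun m V U f => forall k, class_C k U f.

(* For K = R[i], [differentiable] is complex differentiability. *)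
Definition holomorphic_on (K : numFieldType) : regularity K :=
  fun m V U f => forall x, U x -> differentiable f x.

Variant ground := Real | Complex.

Definition ground_field (R : realType) (g : ground) : numFieldType :=
  match g with Real => R | Complex => R[i] end.

Definition regular (R : realType) (g : ground) : regularity (ground_field R g) :=
  match g return regularity (ground_field R g) with
  | Real => @smooth_on R
  | Complex => @holomorphic_on R[i]
  end.
Arguments regular : clear implicits.

Section Manifolds.
Context {K : numFieldType} (reg : regularity K) (n : nat).

(* [chart_map] and [chart_inv] are total functions; they are meaningful on [dom] and on
   [chart_map @` dom] respectively. *)
Record chart (T : topologicalType) := Chart {
  dom : set T;
  chart_map : T -> 'rV[K]_n;
  chart_inv : 'rV[K]_n -> T;
  dom_open : open dom;
  chart_image_open : open (chart_map @` dom);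
  chart_mapK : forall x, dom x -> chart_inv (chart_map x) = x;
  chart_map_continuous : {within dom, continuous chart_map};
  chart_inv_continuous : {within chart_map @` dom, continuous chart_inv}
}.

(* The atlas need not be maximal. [chart_at] fixes at each point a chart in
   which coordinate expressions are evaluated. *)
Record manifold := Manifold {
  points :> topologicalType;
  points_hausdorff : hausdorff_space points;
  points_paracompact : paracompact points;
  atlas : set (chart points);
  chart_at : points -> chart points;
  chart_at_atlas : forall x, atlas (chart_at x);
  chart_at_dom : forall x, dom (chart_at x) x;
  atlas_compatible : forall c d, atlas c -> atlas d ->
    reg (chart_map c @` (dom c `&` dom d)) (chart_map d \o chart_inv c)
}.

(* Local functions on an open set are represented by total functions. *)
Definition regular_fun (M : manifold) (U : set M) (F : M -> K) : Prop :=
  forall c, atlas c -> reg (chart_map c @` (dom c `&` U)) (F \o chart_inv c : _ -> K^o).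

Definition partial (M : manifold) (c : chart M) (i : 'I_n) (F : M -> K) (x : M)
    : K :=
  'D_(delta_mx 0 i) (F \o chart_inv c : 'rV[K]_n -> K^o) (chart_map c x).

(* The bracket of the bivector field with components B c x i j in the chart c,
   i.e. of 1/2 \sum_(i, j) B c x i j d_i /\ d_j. *)
Definition bracket_of (M : manifold) (B : chart M -> M -> 'M[K]_n)
    (F G : M -> K) (x : M) : K :=
  \sum_(i < n) \sum_(j < n) B (chart_at x) x i j *
    partial (chart_at x) i F x * partial (chart_at x) j G x.

(* A bivector field is given by its components in the charts of the atlas; the
   components of different charts are related by the tensor transformation law
   (in MathComp's row-vector convention, 'J f y i j is the i-th partial
   derivative of the j-th component of f). *)
Record poisson_manifold := PoissonManifold {
  base :> manifold;
  bivector : chart base -> base -> 'M[K]_n;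
  bivector_antisym : forall c x, atlas c -> dom c x ->
    (bivector c x)^T = - bivector c x;
  bivector_regular : forall c, atlas c ->
    reg (chart_map c @` dom c) (bivector c \o chart_inv c);
  bivector_change : forall c d x, atlas c -> atlas d -> dom c x -> dom d x ->
    let J := jacobian (chart_map d \o chart_inv c) (chart_map c x) in
    bivector d x = J^T *m bivector c x *m J;
  jacobi : forall (U : set base) (F G H : base -> K), open U ->
    regular_fun U F -> regular_fun U G -> regular_fun U H ->
    forall x, U x ->
      let br := bracket_of bivector in
      br F (br G H) x + br G (br H F) x + br H (br F G) x = 0
}.

Definition bracket (P : poisson_manifold) (F G : P -> K) : P -> K :=
  bracket_of (@bivector P) F G.

Definition symplectic_on (P : poisson_manifold) (U : set P) : Prop :=
  forall x, U x -> forall c, atlas c -> dom c x -> bivector c x \in unitmx.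

Definition symplectic_manifold (P : poisson_manifold) : Prop :=
  symplectic_on (setT : set P).

Definition regular_map (M N : manifold) (phi : M -> N) : Prop :=
  continuous phi /\
  forall c d, atlas c -> atlas d ->
    reg (chart_map c @` (dom c `&` phi @^-1` dom d)) (chart_map d \o phi \o chart_inv c).

Definition poisson_morphism (P Q : poisson_manifold) (phi : P -> Q) : Prop :=
  regular_map phi /\
  forall (U : set Q) (F G : Q -> K), open U ->
    regular_fun U F -> regular_fun U G ->
    forall x, U (phi x) ->
      bracket (F \o phi) (G \o phi) x = bracket F G (phi x).

Record symplectic_resolution (M : poisson_manifold) := SymplecticResolution {
  source : poisson_manifold;
  source_symplectic : symplectic_manifold source;
  resolution_map : source -> M;
  resolution_map_surjective : set_surj setT setT resolution_map;
  resolution_map_poisson : poisson_morphism resolution_map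
}.

End Manifolds.

(* Main.v *)
From HB Require Import structures.
Require Import Defs.
From mathcomp Require Import all_boot all_order all_algebra.
From mathcomp Require Import finmap complex zify ring lra.
From mathcomp Require Import all_classical all_reals all_analysis.

Set Implicit Arguments.
Unset Strict Implicit.
Unset Printing Implicit Defensive.

Import Order.TTheory GRing.Theory Num.Theory.
Import numFieldNormedType.Exports.

Local Open Scope classical_set_scope.
Local Open Scope ring_scope.

(** Let K be the ground field. The open set in question is the locus U of M
    where the matrix of the bivector field is invertible; it is open because
    the determinant is continuous, and whether the matrix is invertible does
    not depend on the chart because a change of chart replaces B by J^T B J.

    Density of U is a Sard argument. Evaluated on coordinate functions, the
    Poisson condition on phi : Sigma -> M says that in charts
    pi(phi(x)) = J^T Pi(x) J, where J is the Jacobian matrix of phi at x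
    (poisson_morphism_bivector). Since Pi(x) is invertible, phi(x) lies in U
    as soon as J is invertible. If a nonempty open set V missed U, then phi
    would be critical at every point above V, so by surjectivity every point
    of V would be a critical value. As Sigma is paracompact and separable,
    countably many charts cover it (charts_cover_countable), and V would be
    a countable union of images of critical sets of maps K^n -> K^n. These
    images are null sets, a countable union of null sets is null, and a null
    set contains no ball.

    The version of Sard's theorem used here, between spaces of equal
    dimension, assumes differentiability at each critical point only, and so
    covers smooth and holomorphic maps alike (null_flat_image). If df(x) is
    singular, then f maps a cube of side h around x into a slab of width of
    order h and thickness e h, which is covered by cubes of total volume of
    order e h^n (covered_by_slab). How small h must be depends on x. Each
    critical point is therefore assigned the largest dyadic cube around it
    whose side is small enough for some critical point inside it, possibly
    another one; these dyadic cubes are pairwise disjoint, so their volumes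
    add up to at most the volume of the ambient cube
    (dyadic_antichain_volume), and the image has outer measure of order e
    (covered_image_flat_at_scale).

    Volume is handled combinatorially: covered_by A v expresses that the outer
    measure of A is at most v. It is countably subadditive
    (covered_by_bigcup), and counting the points of a fine grid after
    extracting a finite subcover shows that a cube has positive outer measure
    (covered_by_cube_ge). The complex case is reduced to the real one by
    taking real and imaginary parts as coordinates: a complex linear form
    that kills the image of df(x) has a real part that is a nonzero real
    linear form with the same property (flat_at_to_real). *)

(** * Outer measure by coverings with cubes *)

Lemma rV_norm_leP (K : numFieldType) (n : nat) (x : 'rV[K]_n) (e : K) :
  0 <= e -> `|x| <= e <-> forall j, `|x 0 j| <= e.
Proof.
move=> /nonnegP[{}e]; rewrite {1}/Num.norm /= mx_normE num_le; split.
  by move=> /bigmax_leP[_ xe] j; have := xe (0, j) isT; rewrite -num_le.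
move=> xe; apply/bigmax_leP; split => [|[i j] _] /=; last first.
  by rewrite -num_le /= ord1.
by rewrite -num_le /=.
Qed.

Section Covering.
Context {R : realType} {N : nat}.
Implicit Types (A : set 'rV[R]_N) (v : R).

(** A pair [(c, r)] stands for the closed ball of the sup norm, a cube of side
    [2 * r], and counts for [r ^+ N]; the factor 2^N is dropped. Bounding all
    finite partial sums amounts to bounding the sum of the family, which may
    be infinite. *)
Definition covered_by A v := exists B : set ('rV[R]_N * R),
  [/\ forall b, B b -> 0 < b.2,
      A `<=` [set x | exists2 b, B b & `|x - b.1| <= b.2] &
      forall s, uniq s -> (forall b, b \in s -> B b) ->
        \sum_(b <- s) b.2 ^+ N <= v].

Lemma covered_by_le A v v' : v <= v' -> covered_by A v -> covered_by A v'.
Proof.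
move=> vv' [B [B0 AB Bv]]; exists B; split => // s us sB.
exact: le_trans (Bv s us sB) vv'.
Qed.

Lemma covered_by_cube (c : 'rV[R]_N) (r : R) : 0 < r ->
  covered_by [set x | `|x - c| <= r] (r ^+ N).
Proof.
move=> r0; exists [set (c, r)]; split => [b -> //|x xr|s us sB].
  by exists (c, r).
have : (size s <= size [:: (c, r)])%N.
  by apply: uniq_leq_size => // b /sB ->; rewrite inE.
case: s us sB => [|b [|//]] _ sB _.
  by rewrite big_nil exprn_ge0// ltW.
by rewrite big_seq1 (sB b) ?inE.
Qed.

(** Subadditivity of the outer measure, for an arbitrary index set: merge the
    given coverings, and attribute each cube of the merged family to one index
    whose covering contains it. *)
Lemma covered_by_bigcup (I : choiceType) (P : set I) (F : I -> set 'rV[R]_N)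
    (w : I -> R) A v :
  (forall i, P i -> covered_by (F i) (w i)) ->
  (forall s, uniq s -> (forall i, i \in s -> P i) -> \sum_(i <- s) w i <= v) ->
  A `<=` \bigcup_(i in P) F i -> covered_by A v.
Proof.
move=> Fw wv AF.
have /choice[B Bp] : forall i, exists B : set ('rV[R]_N * R), P i ->
  [/\ forall b, B b -> 0 < b.2,
      F i `<=` [set x | exists2 b, B b & `|x - b.1| <= b.2] &
      forall s, uniq s -> (forall b, b \in s -> B b) ->
        \sum_(b <- s) b.2 ^+ N <= w i].
  move=> i; have [/Fw[B ?]|nPi] := pselect (P i); first by exists B.
  by exists set0.
exists (\bigcup_(i in P) B i); split.
- by move=> b [i Pi]; have [+ _ _] := Bp i Pi; apply.
- move=> x /AF[i Pi Fix]; have [_ + _] := Bp i Pi.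
  by move=> /(_ _ Fix)[b Bib xb]; exists b => //; exists i.
move=> s us sB.
have [->|[b0 b0s]] : s = [::] \/ exists b, b \in s.
- by case: s {us sB} => [|b s]; [left|right; exists b; rewrite inE eqxx].
- rewrite big_nil.
  by apply: le_trans (wv [::] isT _); rewrite ?big_nil.
have [i0 _ _] := sB b0 b0s.
have /choice[k kp] : forall b, exists i, b \in s -> P i /\ B i b.
  move=> b; have [/sB[i Pi Bib]|] := boolP (b \in s); last by exists i0.
  by exists i.
pose t := undup (map k s).
have -> : \sum_(b <- s) b.2 ^+ N =
    \sum_(i <- t) \sum_(b <- s | k b == i) b.2 ^+ N.
  rewrite (exchange_big_dep xpredT)//= big_seq [RHS]big_seq.
  apply: eq_bigr => b bs.
  rewrite -big_filter (_ : [seq i <- t | k b == i] = [:: k b]) ?big_seq1//.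
  rewrite (@eq_filter _ _ (pred1 (k b))); last by move=> i /=; rewrite eq_sym.
  by rewrite filter_pred1_uniq ?undup_uniq// mem_undup map_f.
have tP i : i \in t -> P i.
  by rewrite mem_undup => /mapP[b /kp[? _] ->].
apply: le_trans (wv t (undup_uniq _) tP).
rewrite big_seq [leRHS]big_seq; apply: ler_sum => i /tP Pi.
rewrite -big_filter; have [_ _] := Bp i Pi; apply; first exact: filter_uniq.
by move=> b; rewrite mem_filter => /andP[/eqP <- /kp[]].
Qed.

Lemma covered_by_sub A A' v : A `<=` A' -> covered_by A' v -> covered_by A v.
Proof.
by move=> AA' [B [B0 AB Bv]]; exists B; split => // x /AA'/AB.
Qed.

Lemma card_ord_diameter (M : nat) (S : {set 'I_M}) (t : R) : 0 <= t ->
  (forall k l, k \in S -> l \in S -> `|k%:R - l%:R| <= t :> R) ->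
  #|S|%:R <= t + 1.
Proof.
move=> t0 St; have [->|[k0 k0S]] := set_0Vmem S.
  by rewrite cards0 addr_ge0.
have [k kS kmin] := arg_minnP (fun i : 'I_M => i : nat) k0S.
pose g (l : 'I_M) : 'I_(Num.truncn t).+1 := inord (l - k).
have gE l : l \in S -> g l = (l - k)%N :> nat.
  move=> lS; rewrite /g inordK// ltnS truncn_ge_nat//.
  by rewrite natrB ?kmin//; apply: le_trans (St l k lS kS); exact: ler_norm.
have ginj : {in S &, injective g}.
  move=> l l' lS l'S /(congr1 val)/=; rewrite !gE// => ll'.
  apply: val_inj => /=.
  by rewrite -(subnK (kmin l lS)) ll' subnK// kmin.
rewrite -(card_in_imset ginj); apply: (@le_trans _ _ (Num.truncn t).+1%:R).
  by rewrite ler_nat -[leqRHS]card_ord max_card.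
by rewrite -[leLHS]natr1 lerD2r truncn_le.
Qed.

(** The grid has mesh [r / M], and the last hypothesis says that the radius d is
    at least the mesh, so that the rounding error in each direction is
    absorbed in the factor 3. *)
Lemma card_grid_in_cube (M : nat) (a c : 'rV[R]_N) (r d : R) :
  0 < r -> 0 <= d -> 1 <= d * M%:R / r ->
  #|[set w : {ffun 'I_N -> 'I_M} |
     `|\row_j (a 0 j + r * (w j)%:R / M%:R) - c| <= d]%SET|%:R
  <= (3 * d * M%:R / r) ^+ N.
Proof.
move=> r0 d0 dM.
have M0 : 0 < M%:R :> R.
  rewrite lt_neqAle ler0n andbT; apply/eqP => M0.
  by move: dM; rewrite -M0 mulr0 mul0r ler10.
pose F j := [set k : 'I_M | `|a 0 j + r * k%:R / M%:R - c 0 j| <= d]%SET.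
apply: (@le_trans _ _ #|family (fun j => mem (F j))|%:R).
  rewrite ler_nat; apply/subset_leq_card/fintype.subsetP => w.
  rewrite inE => /(rV_norm_leP _ d0) wd; apply/familyP => j.
  by rewrite inE; have := wd j; rewrite !mxE.
rewrite card_family.
have FE j : #|F j|%:R <= 3 * d * M%:R / r.
  apply: (@le_trans _ _ (2 * (d * M%:R / r) + 1)); last by lra.
  apply: (@card_ord_diameter M (F j)); first by apply: mulr_ge0 => //; lra.
  move=> k l; rewrite !inE => kd ld.
  have : `|r * k%:R / M%:R - r * l%:R / M%:R| <= 2 * d.
    have -> : r * k%:R / M%:R - r * l%:R / M%:R =
      (a 0 j + r * k%:R / M%:R - c 0 j)
      - (a 0 j + r * l%:R / M%:R - c 0 j) :> R by ring.
    by apply: le_trans (ler_normB _ _) _; lra.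
  have -> : r * k%:R / M%:R - r * l%:R / M%:R = (k%:R - l%:R) * (r / M%:R).
    by ring.
  rewrite normrM (gtr0_norm (divr_gt0 r0 M0)) -ler_pdivlMr ?divr_gt0//.
  by rewrite invfM invrK; congr (_ <= _); ring.
set q := [seq _ | _ : _].
have sq : size q = N by rewrite size_map -cardE card_ord.
have : forall m, m \in q -> m%:R <= 3 * d * M%:R / r :> R.
  move=> m /mapP[j _ ->]; apply: le_trans (FE j); rewrite ler_nat.
  by apply/subset_leq_card/fintype.subsetP => k; rewrite !inE.
rewrite -[in X in _ -> _ <= X]sq.
elim: q {sq} => [|m s IH] sd /=; first by rewrite expr0.
rewrite natrM exprS ler_pM ?sd ?mem_head// IH// => k ks.
by rewrite sd// inE ks orbT.
Qed.

(** By compactness finitely many cubes suffice, after doubling their radii to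
    make them open; then every point of a grid of M^N points, with M large
    compared to all the radii, lies in one of them, and the number of grid
    points in each is bounded by its volume, up to a factor 3^N; whence the
    factor 6 = 2 * 3. *)
Lemma covered_by_cube_ge (a : 'rV[R]_N) (r v : R) : 0 < r ->
  covered_by [set x | `|x - a| <= r] v -> r ^+ N <= 6 ^+ N * v.
Proof.
move=> r0 [B [B0 AB Bv]].
have Acpt : compact [set x | `|x - a| <= r].
  apply: bounded_closed_compact.
    exists (`|a| + r); split; first exact: num_real.
    move=> y ry x /= xr; apply: ltW; apply: le_lt_trans ry.
    rewrite -[x](subrK a) addrC; apply: le_trans (ler_normD _ _) _.
    by rewrite lerD2l.
  have := @closed_closed_ball_ R 'rV[R]_N a r.
  by rewrite /closed_ball_; under eq_set do rewrite distrC.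
rewrite compact_cover in Acpt.
have [||s sB sA] := Acpt _ B (fun b => ball b.1 (2 * b.2)).
- by move=> b Bb; apply: ball_open; rewrite mulr_gt0// B0.
- move=> x /AB[b Bb xb]; exists b => //; rewrite -ball_normE /ball_/= distrC.
  by apply: le_lt_trans xb _; rewrite ltr_pMl ?B0// ltr1n.
have sB' b : b \in enum_fset s -> B b.
  by move=> bs; have := sB b bs; rewrite inE.
have us : uniq (enum_fset s) by exact: fset_uniq.
have [M MP] : exists M : nat, (0 < M)%N /\
    forall b, b \in enum_fset s -> 1 <= (2 * b.2) * M%:R / r.
  elim: (enum_fset s) sB' => [|b t IH] tB; first by exists 1%N.
  have [|M [M0 Mt]] := IH.
    by move=> b' b't; apply: tB; rewrite inE b't orbT.
  have b0 : 0 < b.2 by apply/B0/tB; rewrite mem_head.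
  have [k bk] : exists k : nat, r / (2 * b.2) <= k%:R.
    by exists (Num.truncn (r / (2 * b.2))).+1; apply/ltW/truncnS_gt.
  exists (maxn M k); split; first by rewrite leq_max M0.
  move=> b'; rewrite inE => /predU1P[->|b't].
    rewrite ler_pdivlMr// mul1r mulrC -ler_pdivrMr ?mulr_gt0//.
    by apply: le_trans bk _; rewrite ler_nat leq_maxr.
  have b'0 : 0 < b'.2 by apply/B0/tB; rewrite inE b't orbT.
  apply: le_trans (Mt _ b't) _.
  rewrite ler_pM2r ?invr_gt0// ler_pM2l ?mulr_gt0//.
  by rewrite ler_nat leq_maxl.
case: MP => M0 MP.
have M0' : 0 < M%:R :> R by rewrite ltr0n.
pose grid (w : {ffun 'I_N -> 'I_M}) := \row_j (a 0 j + r * (w j)%:R / M%:R).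
have gridA w : `|grid w - a| <= r.
  apply/rV_norm_leP => [|j]; first exact: ltW.
  rewrite !mxE addrC addKr ger0_norm; last by rewrite divr_ge0// mulr_ge0// ltW.
  by rewrite -mulrA ler_piMr ?ltW// ltr_pdivrMr// mul1r ltr_nat.
pose C (b : 'rV[R]_N * R) := [set w | `|grid w - b.1| <= 2 * b.2]%SET.
have grid_sum : (M ^ N <= \sum_(b <- enum_fset s) #|C b|)%N.
  have <- : #|{ffun 'I_N -> 'I_M}| = (M ^ N)%N by rewrite card_ffun !card_ord.
  rewrite -sum1_card; under [leqRHS]eq_bigr do rewrite -sum1_card.
  rewrite (exchange_big_dep xpredT)//=; apply: leq_sum => w _.
  have [b bs wb] := sA (grid w) (gridA w).
  rewrite (big_rem b bs)/= inE.
  suff -> : `|grid w - b.1| <= 2 * b.2 by [].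
  by move: wb; rewrite -ball_normE /ball_/= distrC => /ltW.
have : M%:R ^+ N <= \sum_(b <- enum_fset s) (3 * (2 * b.2) * M%:R / r) ^+ N.
  rewrite -natrX; apply: (@le_trans _ _ (\sum_(b <- enum_fset s) #|C b|)%N%:R).
    by rewrite ler_nat.
  rewrite natr_sum big_seq [leRHS]big_seq; apply: ler_sum => b bs.
  apply: card_grid_in_cube => //; last exact: MP.
  by rewrite mulr_ge0// ltW// B0//; exact: sB'.
(* The factor M^N cancels. *)
have -> : \sum_(b <- enum_fset s) (3 * (2 * b.2) * M%:R / r) ^+ N =
  M%:R ^+ N * ((6 / r) ^+ N * \sum_(b <- enum_fset s) b.2 ^+ N).
  rewrite !big_distrr /=; apply: eq_bigr => b _.
  by rewrite -!exprMn; congr (_ ^+ _); ring.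
rewrite -{1}[M%:R ^+ N]mulr1 ler_pM2l ?exprn_gt0// => le1.
rewrite -[leLHS]mulr1; apply: (@le_trans _ _ (r ^+ N * ((6 / r) ^+ N * v))).
  rewrite ler_pM2l ?exprn_gt0//; apply: le_trans le1 _.
  by rewrite ler_wpM2l ?exprn_ge0 ?divr_ge0 ?(ltW r0)// Bv.
by rewrite mulrA -exprMn mulrCA mulfV ?mulr1// gt_eqF.
Qed.
End Covering.

Definition null (R : realType) (N : nat) (A : set 'rV[R]_N) :=
  forall e : R, 0 < e -> covered_by A e.

Lemma sum_half_pow (R : realType) (s : seq nat) : uniq s ->
  \sum_(i <- s) 2^-1 ^+ i.+1 <= 1 :> R.
Proof.
move=> us; pose n := (\max_(i <- s) i).+1.
have sn : {subset s <= iota 0 n}.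
  by move=> i si; rewrite mem_iota /= add0n ltnS; apply: leq_bigmax_seq.
have -> : \sum_(i <- s) 2^-1 ^+ i.+1 =
    \sum_(i <- iota 0 n | i \in s) 2^-1 ^+ i.+1 :> R.
  rewrite -[RHS]big_filter; apply/perm_big/uniq_perm => //.
    exact/filter_uniq/iota_uniq.
  by move=> i; rewrite mem_filter; case: (boolP (i \in s)) => //= /sn ->.
apply: (@le_trans _ _ (\sum_(i <- iota 0 n) 2^-1 ^+ i.+1)).
  rewrite big_mkcond; apply: ler_sum => i _; case: ifP => // _.
suff -> : \sum_(i <- iota 0 n) 2^-1 ^+ i.+1 = 1 - 2^-1 ^+ n :> R.
  by rewrite gerBl exprn_ge0.
elim: n {sn} => [|n IH]; first by rewrite big_nil expr0 subrr.
by rewrite -addn1 iotaD big_cat/= big_seq1 IH add0n addn1 exprS; field.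
Qed.

Lemma null_bigcup (R : realType) (N : nat) (F : nat -> set 'rV[R]_N) :
  (forall i, null (F i)) -> null (\bigcup_i F i).
Proof.
move=> F0 e e0.
apply: (@covered_by_bigcup _ _ _ setT F (fun i => e * 2^-1 ^+ i.+1)) => //.
- by move=> i _; apply: F0; rewrite mulr_gt0// exprn_gt0.
- move=> s us _; rewrite -mulr_sumr ler_piMr ?(ltW e0)//.
  exact: sum_half_pow.
Qed.

Lemma null_empty_interior (R : realType) (N : nat) (A : set 'rV[R]_N)
    (a : 'rV[R]_N) :
  null A -> ~ nbhs a A.
Proof.
move=> A0 /nbhs_ballP[d /= d0 dA].
have d20 : 0 < d / 2 by rewrite divr_gt0.
have e0 : 0 < (d / 2 / 6) ^+ N / 2 by rewrite divr_gt0// exprn_gt0// divr_gt0.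
have sub : [set x | `|x - a| <= d / 2] `<=` A.
  move=> x /= xa; apply: dA; rewrite -ball_normE /ball_/= distrC.
  by apply: le_lt_trans xa _; rewrite ltr_pdivrMr// ltr_pMr// ltr1n.
have := covered_by_cube_ge d20 (covered_by_sub sub (A0 _ e0)).
rewrite mulrA -exprMn (_ : 6 * (d / 2 / 6) = d / 2); last by field.
have := exprn_gt0 N d20; lra.
Qed.

(** * The image of a small cube around a flat point *)

(** The entry of index [j0] of a point z of the slab is determined by the other
    entries up to an error [e * h], because [v j0 0 = 1]. Approximating each of
    the other N - 1 entries of z - c in the range [-m h, m h] by a multiple of
    [e * h] leaves at most (2 m / e + 1)^(N - 1) cases, and as the entries of v
    are bounded by 1 the accumulated error in the entry [j0] is at most
    [N * (e * h)]. The gain of one factor e comes from the one direction that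
    need not be subdivided. *)
Lemma covered_by_slab (R : realType) (N : nat) (c : 'rV[R]_N) (v : 'cV[R]_N)
    (j0 : 'I_N) (m h e : R) :
  v j0 0 = 1 -> (forall j, `|v j 0| <= 1) -> 0 < h -> 0 <= m -> 0 < e <= 1 ->
  covered_by [set z | `|z - c| <= m * h /\ `|((z - c) *m v) 0 0| <= e * h]
    ((2 * m + 1) ^+ N.-1 * N.+1%:R ^+ N * e * h ^+ N).
Proof.
move=> vj0 v1 h0 m0 /andP[e0 e1].
have d0 : 0 < e * h by rewrite mulr_gt0.
pose Q := (Num.truncn (2 * m / e)).+1.
(* [o a i] approximates the entry of z - c of index [lift j0 i]. *)
pose o (a : {ffun 'I_N.-1 -> 'I_Q}) i := - (m * h) + e * h * (a i)%:R.
pose ctr a := \row_j (c 0 j + if unlift j0 j is Some i then o a i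
                              else - \sum_i o a i * v (lift j0 i) 0).
have N0 : (0 < N)%N := leq_ltn_trans (leq0n _) (ltn_ord j0).
have r0 : 0 < N.+1%:R * (e * h) by rewrite mulr_gt0.
apply: (@covered_by_bigcup _ _ _ setT
  (fun a => [set x | `|x - ctr a| <= N.+1%:R * (e * h)])
  (fun=> (N.+1%:R * (e * h)) ^+ N)).
- by move=> a _; exact: covered_by_cube.
- move=> s us _.
  rewrite big_const_seq count_predT iter_addr_0.
  have sQ : (size s)%:R <= ((2 * m + 1) / e) ^+ N.-1.
    apply: (@le_trans _ _ (Q ^ N.-1)%N%:R).
      rewrite ler_nat -[X in (_ <= _ ^ X)%N]card_ord.
      rewrite -[X in (_ <= X ^ _)%N]card_ord -card_ffun cardE.
      apply: uniq_leq_size => // a _.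
      by rewrite mem_enum.
    rewrite natrX lerXn2r ?nnegrE ?divr_ge0 ?(ltW e0)//; first by lra.
    rewrite -[leLHS]natr1; apply: (@le_trans _ _ (2 * m / e + 1)).
      by rewrite lerD2r truncn_le divr_ge0 ?(ltW e0)//; lra.
    by rewrite [leRHS]mulrDl lerD2l mul1r invf_ge1.
  rewrite -[leLHS]mulr_natl.
  apply: (@le_trans _ _
    (((2 * m + 1) / e) ^+ N.-1 * (N.+1%:R * (e * h)) ^+ N)).
    by rewrite ler_wpM2r// exprn_ge0// ltW.
  rewrite le_eqVlt; apply/orP; left; apply/eqP.
  rewrite !exprMn exprVn.
  have -> : e ^+ N = e * e ^+ N.-1 by rewrite -exprS prednK.
  field.
  by rewrite expf_neq0// gt_eqF.
move=> z [zc zv].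
have zcj j : `|z 0 j - c 0 j| <= m * h.
  have /(rV_norm_leP _ (mulr_ge0 m0 (ltW h0)))/(_ j) := zc.
  by rewrite !mxE.
pose t i := (z 0 (lift j0 i) - c 0 (lift j0 i) + m * h) / (e * h).
have t0 i : 0 <= t i.
  rewrite divr_ge0 ?(ltW d0)//; have := zcj (lift j0 i).
  by rewrite ler_norml; lra.
have tQ i : (Num.truncn (t i) < Q)%N.
  rewrite ltnS; apply: le_truncn; rewrite ler_pdivrMr//.
  have -> : 2 * m / e * (e * h) = 2 * m * h by field; rewrite gt_eqF.
  have := zcj (lift j0 i); rewrite ler_norml; lra.
pose a := [ffun i => Ordinal (tQ i)].
exists a => //=.
have oP i : `|z 0 (lift j0 i) - c 0 (lift j0 i) - o a i| <= e * h.
  rewrite /o ffunE /=.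
  have -> : z 0 (lift j0 i) - c 0 (lift j0 i) -
    (- (m * h) + e * h * (Num.truncn (t i))%:R) =
    (t i - (Num.truncn (t i))%:R) * (e * h).
    by rewrite /t; field; rewrite !gt_eqF.
  have /andP[ti1 ti2] := truncn_itv (t0 i).
  rewrite normrM (gtr0_norm d0) ler_piMl ?(ltW d0)//.
  rewrite ger0_norm ?subr_ge0// lerBlDr addrC natr1; exact: ltW.
apply/rV_norm_leP => [|j]; first exact: ltW.
rewrite !mxE; case: unliftP => [i ->|->].
  rewrite opprD addrA; apply: le_trans (oP i) _.
  by rewrite ler_peMl ?(ltW d0)// ler1n.
move: zv; rewrite mxE (bigD1_ord j0)//= vj0 !mxE mulr1 => zv.
have sumE :
    \sum_i (z 0 (lift j0 i) - c 0 (lift j0 i) - o a i) * v (lift j0 i) 0 =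
    \sum_i (z - c) 0 (lift j0 i) * v (lift j0 i) 0
    - \sum_i o a i * v (lift j0 i) 0.
  by rewrite -sumrB; apply: eq_bigr => i _; rewrite !mxE mulrBl.
have -> : z 0 j0 - (c 0 j0 - \sum_i o a i * v (lift j0 i) 0) =
  (z 0 j0 - c 0 j0 + \sum_i (z - c) 0 (lift j0 i) * v (lift j0 i) 0) -
  \sum_i (z 0 (lift j0 i) - c 0 (lift j0 i) - o a i) * v (lift j0 i) 0.
  by rewrite sumE; ring.
apply: le_trans (ler_normB _ _) _; rewrite -natr1 mulrDl mul1r addrC lerD//.
apply: le_trans (ler_norm_sum _ _ _) _.
apply: (@le_trans _ _ (\sum_(i < N.-1) e * h)).
  apply: ler_sum => i _; rewrite normrM -[leRHS]mulr1 ler_pM//.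
rewrite sumr_const card_ord -[leLHS]mulr_natl ler_wpM2r ?(ltW d0)// ler_nat.
exact: leq_pred.
Qed.

(** * Disjoint dyadic cubes *)

(** A pair [(k, i)] stands for the cube of side 2^-k with lower corner
    i / 2^k inside [0, T]^N, and division by a power of 2 computes the cube of
    a coarser level around a given one. The last hypothesis says that no
    cube of the family contains another one. Refining everything to the finest
    level L that occurs, cubes become disjoint sets of cells among the
    (T 2^L)^N cells of that level. *)
Lemma dyadic_antichain_volume (R : realType) (N T : nat)
    (s : seq (nat * {ffun 'I_N -> nat})) :
  (0 < T)%N -> uniq s ->
  (forall b, b \in s -> forall j, (b.2 j < T * 2 ^ b.1)%N) ->
  (forall b b', b \in s -> b' \in s -> (b.1 <= b'.1)%N ->
     (forall j, b'.2 j %/ 2 ^ (b'.1 - b.1) = b.2 j)%N -> b = b') ->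
  \sum_(b <- s) (2^-1 ^+ b.1) ^+ N <= T%:R ^+ N :> R.
Proof.
move=> T0 us sT santi; pose L := (\max_(b <- s) b.1)%N.
have sL b : b \in s -> (b.1 <= L)%N by move=> bs; exact: leq_bigmax_seq.
have [X XE] : exists X, (T * 2 ^ L = X.+1)%N.
  by exists (T * 2 ^ L).-1; rewrite prednK// muln_gt0 T0 expn_gt0.
pose D (b : nat * {ffun 'I_N -> nat}) := [set w : {ffun 'I_N -> 'I_X.+1} |
  [forall j, (w j %/ 2 ^ (L - b.1) == b.2 j)%N]]%SET.
have D_ge b : b \in s -> ((2 ^ (L - b.1)) ^ N <= #|D b|)%N.
  move=> bs; set q := (2 ^ (L - b.1))%N.
  have q0 : (0 < q)%N by rewrite expn_gt0.
  have bX j (u : 'I_q) : (b.2 j * q + u < X.+1)%N.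
    rewrite -XE (_ : (T * 2 ^ L = T * 2 ^ b.1 * q)%N); last first.
      by rewrite -mulnA -expnD subnKC ?sL.
    apply: (@leq_trans ((b.2 j).+1 * q)).
      by rewrite mulSn; have := ltn_ord u; lia.
    by rewrite leq_mul2r sT// orbT.
  pose g (u : {ffun 'I_N -> 'I_q}) := [ffun j => Ordinal (bX j (u j))].
  have ginj : injective g.
    move=> u u' /ffunP uu'; apply/ffunP => j; apply: val_inj.
    by have := congr1 val (uu' j); rewrite !ffunE /= => /addnI.
  have -> : (q ^ N = #|g @: finset.setT|)%N.
    by rewrite card_imset// finset.cardsT card_ffun !card_ord.
  apply/subset_leq_card/fintype.subsetP => w /imsetP[u _ ->].
  rewrite inE; apply/forallP => j; rewrite ffunE /=.
  by rewrite divnMDl// divn_small// addn0.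
have D_sum : (\sum_(b <- s) #|D b| <= (T * 2 ^ L) ^ N)%N.
  have -> : ((T * 2 ^ L) ^ N = #|{ffun 'I_N -> 'I_X.+1}|)%N.
    by rewrite card_ffun !card_ord XE.
  under eq_bigr do rewrite -sum1_card.
  rewrite -sum1_card (exchange_big_dep xpredT)//=; apply: leq_sum => w _.
  rewrite sum1_count -size_filter.
  have : {in [seq b <- s | w \in D b] &, forall b b', b = b'}.
    move=> b b'; rewrite !mem_filter !inE.
    move=> /andP[/forallP wb bs] /andP[/forallP wb' b's].
    wlog bb' : b b' wb wb' bs b's / (b.1 <= b'.1)%N.
      move=> H; have [bb'|/ltnW bb'] := leqP b.1 b'.1; first exact: H.
      by apply/esym/H.
    apply: santi => // j; rewrite -(eqP (wb j)) -(eqP (wb' j)) -divnMA -expnD.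
    suff -> : (L - b'.1 + (b'.1 - b.1) = L - b.1)%N by [].
    by move: (sL _ b's) bb'; move: (b.1) (b'.1) (L) => *; lia.
  have := filter_uniq (fun b => w \in D b) us.
  case: [seq _ <- _ | _] => [//|b [//|b' t]] /= /andP[+ _] eqb.
  by rewrite (eqb b b') ?inE ?eqxx ?orbT.
have sum_le : (\sum_(b <- s) (2 ^ (L - b.1)) ^ N <= (T * 2 ^ L) ^ N)%N.
  apply: leq_trans D_sum; rewrite big_seq [leqRHS]big_seq.
  by apply: leq_sum => b /D_ge.
have : (\sum_(b <- s) (2 ^ (L - b.1)) ^ N)%N%:R <= ((T * 2 ^ L) ^ N)%N%:R :> R.
  by rewrite ler_nat.
rewrite natr_sum natrX natrM exprMn -ler_pdivrMr ?exprn_gt0//.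
apply: le_trans; rewrite mulr_suml big_seq [leRHS]big_seq le_eqVlt.
apply/orP; left; apply/eqP/eq_bigr => b bs.
rewrite natrX -expr_div_n; congr (_ ^+ _).
rewrite -[in (2 ^ L)%N](subnK (sL b bs)) expnD natrM invfM.
by rewrite mulVKf ?natrX ?exprVn.
Qed.

Lemma truncn_divn (R : realType) (x : R) (q : nat) : 0 <= x -> (0 < q)%N ->
  (Num.truncn x %/ q)%N = Num.truncn (x / q%:R).
Proof.
move=> x0 q0; apply/esym/truncn_def.
have q0' : 0 < q%:R :> R by rewrite ltr0n.
have /andP[x1 x2] := truncn_itv x0.
apply/andP; split.
  rewrite ler_pdivlMr// -natrM; apply: le_trans x1; rewrite ler_nat.
  exact: leq_divM.
rewrite ltr_pdivrMr// -natrM; apply: lt_le_trans x2 _; rewrite ler_nat.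
have := ltn_pmod (Num.truncn x) q0; have := divn_eq (Num.truncn x) q.
by rewrite mulSn; lia.
Qed.

(** * Sard's theorem at flat points *)

(** This is what remains of the differentiability of f at x and of the
    singularity of the Jacobian: f is Lipschitz at x, and the linear form v
    vanishes on the image of the differential. Unlike the differential, this
    passes from complex to real coordinates in the same form. *)
Definition flat_at (K : numFieldType) (N : nat) (f : 'rV[K]_N -> 'rV[K]_N)
    (x : 'rV[K]_N) := exists v : 'cV[K]_N,
  [/\ v != 0,
      exists C : K, \forall y \near x, `|f y - f x| <= C * `|y - x| &
      forall e : K, 0 < e ->
        \forall y \near x, `|((f y - f x) *m v) 0 0| <= e * `|y - x|].

Section Sard.
Context {R : realType} {N : nat} (f : 'rV[R]_N -> 'rV[R]_N).

(** A version of [flat_at] at the single scale 2^-k, with v normalized so that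
    its largest entry in absolute value is 1, which is what [covered_by_slab]
    consumes; m bounds the Lipschitz constant. *)
Definition flat_at_scale (m : nat) (e : R) (x : 'rV[R]_N) (k : nat) :=
  exists (j0 : 'I_N) (v : 'cV[R]_N), [/\ v j0 0 = 1, (forall j, `|v j 0| <= 1) &
    forall y, `|y - x| <= 2^-1 ^+ k ->
      `|f y - f x| <= m%:R * 2^-1 ^+ k /\
      `|((f y - f x) *m v) 0 0| <= e * 2^-1 ^+ k].

(** The scale k may depend on x. The constant does not depend on e. Each point
    of E is placed in the largest dyadic cube around it that contains a point
    of E flat at the scale of that cube; the image of such a cube lies in a
    slab around the image of this flat point, and the selected cubes do not
    contain one another, by maximality. *)
Lemma covered_image_flat_at_scale (E : set 'rV[R]_N) (m : nat) (e : R) :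
  (0 < m)%N -> 0 < e <= 1 ->
  (forall x, E x -> `|x| < m%:R /\ exists k, flat_at_scale m e x k) ->
  covered_by (f @` E)
    (((2 * m%:R + 1) ^+ N.-1 * N.+1%:R ^+ N * (2 * m)%N%:R ^+ N) * e).
Proof.
move=> m0 e01 Eslab.
(* Shifting by m makes all the entries of the points of E nonnegative. *)
pose cell k (x : 'rV[R]_N) : {ffun 'I_N -> nat} :=
  [ffun j => Num.truncn (2 ^+ k * (x 0 j + m%:R))].
(* Stopping rule: [level x] is the least k for which the cell of x at level k
   contains a point of E that is flat at scale 2^-k. Only this point of the
   cell has to be flat, so the rule depends on the cell and not on x. *)
pose hit k x := exists x',
  [/\ E x', cell k x' = cell k x & flat_at_scale m e x' k].
have pos x j : E x -> 0 <= x 0 j + m%:R < 2 * m%:R.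
  move=> /Eslab[xm _]; have := (rV_norm_leP x (normr_ge0 x)).1 (lexx _) j.
  move=> /le_lt_trans/(_ xm); rewrite ltr_norml => /andP[]; lra.
have /choice[level levelP] x : exists k,
    E x -> hit k x /\ forall l, hit l x -> (k <= l)%N.
  have [Ex|nEx] := pselect (E x); last by exists 0%N.
  have ex : exists k, `[< hit k x >].
    by have [_ [k xk]] := Eslab x Ex; exists k; apply/asboolP; exists x.
  exists (ex_minn ex) => _; case: ex_minnP => k /asboolP xk kmin; split => //.
  by move=> l xl; apply: kmin; apply/asboolP.
pose P := [set (level x, cell (level x) x) | x in E].
have cell_close k x y : E x -> E y -> cell k x = cell k y ->
    `|x - y| <= 2^-1 ^+ k.
  move=> Ex Ey /ffunP xy; apply/rV_norm_leP => [|j]; first exact: exprn_ge0.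
  have := xy j; rewrite !ffunE !mxE => t.
  have p2 : 0 < 2 ^+ k :> R by rewrite exprn_gt0.
  have x0 : 0 <= 2 ^+ k * (x 0 j + m%:R).
    by rewrite mulr_ge0 ?(ltW p2)//; case/andP: (pos x j Ex).
  have y0 : 0 <= 2 ^+ k * (y 0 j + m%:R).
    by rewrite mulr_ge0 ?(ltW p2)//; case/andP: (pos y j Ey).
  have /andP[x1 x2] := truncn_itv x0; have /andP[y1 y2] := truncn_itv y0.
  rewrite -t in y1 y2.
  rewrite exprVn -[leRHS]mul1r ler_pdivlMr// -(gtr0_norm p2) -normrM ler_norml.
  have -> : (x 0 j - y 0 j) * 2 ^+ k =
    2 ^+ k * (x 0 j + m%:R) - 2 ^+ k * (y 0 j + m%:R) by ring.
  move: x1 x2 y1 y2; rewrite -natr1.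
  by set a := 2 ^+ k * _; set b := 2 ^+ k * _; set c := _%:R; lra.
have cell_divn k l x j : E x -> (k <= l)%N ->
    (cell l x j %/ 2 ^ (l - k) = cell k x j)%N.
  move=> Ex kl; rewrite !ffunE truncn_divn ?expn_gt0//; last first.
    by rewrite mulr_ge0 ?exprn_ge0//; case/andP: (pos x j Ex).
  rewrite natrX -[in 2 ^+ l](subnK kl) exprD; congr Num.truncn; field.
  by rewrite expf_neq0.
pose F (i : nat * {ffun 'I_N -> nat}) := f @` [set x | E x /\ cell i.1 x = i.2].
pose C := (2 * m%:R + 1) ^+ N.-1 * N.+1%:R ^+ N * e : R.
apply: (@covered_by_bigcup _ _ _ P F (fun i => C * (2^-1 ^+ i.1) ^+ N)).
- move=> _ [x Ex <-] /=.
  have [[x' [Ex' x'x [j0 [v [v0 v1 x'P]]]]] _] := levelP x Ex.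
  apply: covered_by_sub (covered_by_slab (f x') v0 v1 _ (ler0n _ m) e01).
    2: exact: exprn_gt0.
  move=> _ [y [Ey /= yx] <-]; apply: x'P; apply: cell_close => //.
  by rewrite yx.
- move=> s us sP.
  rewrite -mulr_sumr -(mulrAC _ e) -/C ler_wpM2l//.
    have [/ltW e0 _] := andP e01.
    by rewrite !mulr_ge0// exprn_ge0// addr_ge0 ?mulr_ge0.
  apply: dyadic_antichain_volume => //; first by rewrite muln_gt0.
    move=> b /sP[x Ex <-] j /=; rewrite ffunE.
    have /andP[x0 xm] := pos x j Ex.
    rewrite truncn_lt_nat ?mulr_ge0 ?exprn_ge0//.
    by rewrite mulnC natrM natrX ltr_pM2l ?exprn_gt0// natrM.
  move=> _ _ /sP[x Ex <-] /sP[y Ey <-] /= xy anc.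
  have cxy : cell (level x) x = cell (level x) y.
    by apply/ffunP => j; rewrite -(anc j) cell_divn.
  have [[x' [Ex' x'x x's]] _] := levelP x Ex.
  have yx : (level y <= level x)%N.
    by have [_] := levelP y Ey; apply; exists x'; split => //; rewrite x'x.
  have -> : level y = level x by apply/eqP; rewrite eqn_leq xy yx.
  by rewrite cxy.
- move=> _ [x Ex <-]; exists (level x, cell (level x) x); first by exists x.
  by exists x.
Qed.

(** The set E is exhausted by the sets [Em m] on which both the norm of x and
    the Lipschitz constant at x are at most m + 1; each of them has a null image
    by [covered_image_flat_at_scale], whose constant is the same for all e. *)
Theorem null_flat_image (E : set 'rV[R]_N) :
  (forall x, E x -> flat_at f x) -> null (f @` E).
Proof.
move=> Eflat.
have norm_flat x : E x -> exists (j0 : 'I_N) (v : 'cV[R]_N),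
  [/\ v j0 0 = 1, (forall j, `|v j 0| <= 1) &
  forall e, 0 < e ->
    \forall y \near x, `|((f y - f x) *m v) 0 0| <= e * `|y - x|].
  move=> /Eflat[v [v0 _ vP]].
  have [i vi] : exists i, v i 0 != 0.
    apply/existsP; apply: contraNT v0 => /existsPn v0; apply/eqP/colP => i.
    by rewrite mxE; apply/eqP; have := v0 i; rewrite negbK.
  have [j0 _ jmax] := arg_maxP (fun j => `|v j 0|) (isT : xpredT i).
  have vj0 : 0 < `|v j0 0|.
    by apply: lt_le_trans (jmax i isT); rewrite normr_gt0.
  exists j0, ((v j0 0)^-1 *: v); split => [|j|e e0].
  - by rewrite !mxE mulVf// -normr_gt0.
  - by rewrite !mxE normrM normfV mulrC ler_pdivrMr// mul1r; exact: jmax.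
  - have := vP (e * `|v j0 0|) (mulr_gt0 e0 vj0).
    apply: filterS => y yx; rewrite -scalemxAr mxE normrM normfV mulrC.
    by rewrite ler_pdivrMr// mulrAC.
pose Em m := [set x | E x /\ `|x| < m.+1%:R /\
  \forall y \near x, `|f y - f x| <= m.+1%:R * `|y - x|].
suff H m : null (f @` Em m).
  move=> e e0; apply: covered_by_sub (null_bigcup H e0).
  move=> _ [x Ex <-]; have [v [_ [C Cx] _]] := Eflat x Ex.
  pose m := Num.truncn (Num.max `|x| C).
  have := truncnS_gt (Num.max `|x| C); rewrite -/m gt_max => /andP[xm Cm].
  exists m => //; exists x => //; split => //; split => //.
  apply: filterS Cx => y /le_trans; apply.
  by rewrite ler_wpM2r// ltW.
move=> e e0.
pose C : R := (2 * m.+1%:R + 1) ^+ N.-1 * N.+1%:R ^+ N * (2 * m.+1)%N%:R ^+ N.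
have C0 : 0 < C.
  by rewrite !mulr_gt0 ?exprn_gt0 ?ltr0n ?addn_gt0// addr_gt0// mulr_gt0.
pose e' := Num.min 1 (e / C).
have e'0 : 0 < e' by rewrite lt_min ltr01 divr_gt0.
have e'1 : 0 < e' <= 1 by rewrite e'0 ge_min lexx.
apply: (@covered_by_le _ _ _ (C * e')).
  rewrite mulrC -ler_pdivlMr//; by rewrite ge_min lexx orbT.
apply: covered_image_flat_at_scale => // x [Ex [xm fx]]; split => //.
have [j0 [v [v0 v1 vP]]] := norm_flat x Ex.
have : \forall y \near x, `|f y - f x| <= m.+1%:R * `|y - x| /\
   `|((f y - f x) *m v) 0 0| <= e' * `|y - x|.
  by apply: filterS2 fx (vP e' e'0) => y.
move=> /nbhs_ballP[d /= d0 xd].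
have [k kd] : exists k : nat, 2^-1 ^+ k < d.
  exists (Num.truncn d^-1).+1; rewrite exprVn invf_plt ?posrE ?exprn_gt0//.
  apply: lt_trans (truncnS_gt _) _; rewrite -natrX ltr_nat.
  exact: ltn_expl.
exists k, j0, v; split => // y yx.
have [] : `|f y - f x| <= m.+1%:R * `|y - x| /\
   `|((f y - f x) *m v) 0 0| <= e' * `|y - x|.
  apply: xd; rewrite -ball_normE /ball_/= distrC; exact: le_lt_trans kd.
by move=> y1 y2; split; [apply: le_trans y1 _|apply: le_trans y2 _];
  rewrite ler_wpM2l// ltW.
Qed.
End Sard.

Lemma flat_images_empty_interior_real (R : realType) (n : nat)
    (f : nat -> 'rV[R]_n -> 'rV[R]_n) (E : nat -> set 'rV[R]_n) (a : 'rV[R]_n) :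
  (forall k x, E k x -> flat_at (f k) x) -> ~ nbhs a (\bigcup_k f k @` E k).
Proof.
move=> Ef; apply: null_empty_interior; apply: null_bigcup => k.
exact/null_flat_image/Ef.
Qed.

(** * Complex coordinates as real coordinates *)

Section RealCoordinates.
Context {R : realType} {n : nat}.
(* The topology of R[i] is found through its structure of normed field. *)
Local Notation C := (Num.NumField.sort R[i]).

Definition to_real (z : 'rV[C]_n) : 'rV[R]_(n + n) :=
  row_mx (map_mx (@complex.Re R) z) (map_mx (@complex.Im R) z).

Definition of_real (u : 'rV[R]_(n + n)) : 'rV[C]_n :=
  \row_j complex.Complex (u 0 (lshift n j)) (u 0 (rshift n j)).

Lemma to_realK : cancel to_real of_real.
Proof.
by move=> z; apply/rowP => j; rewrite mxE row_mxEl row_mxEr !mxE; case: (z 0 j).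
Qed.

Lemma of_realK : cancel of_real to_real.
Proof.
move=> u; apply/rowP => j; rewrite -(splitK j); case: (fintype.split j) => k /=.
  by rewrite row_mxEl !mxE.
by rewrite row_mxEr !mxE.
Qed.

Lemma to_realB x y : to_real (x - y) = to_real x - to_real y.
Proof.
apply/rowP => j; rewrite -(splitK j); case: (fintype.split j) => k /=.
  rewrite [RHS]mxE [X in _ = _ + X]mxE !row_mxEl !mxE.
  by case: (x 0 k) (y 0 k) => [a b] [c d].
rewrite [RHS]mxE [X in _ = _ + X]mxE !row_mxEr !mxE.
by case: (x 0 k) (y 0 k) => [a b] [c d].
Qed.

Lemma norm_complexE (z : C) : `|z| = (Normc.normc z)%:C%C.
Proof. by case: z. Qed.

Lemma ger0_Re (z : C) : 0 <= z -> z = (complex.Re z)%:C%C.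
Proof. by move=> z0; rewrite RRe_real// ger0_real. Qed.

Lemma to_real_norm_le (z : 'rV[C]_n) (e : R) :
  0 <= e -> `|z| <= e%:C%C -> `|to_real z| <= e.
Proof.
move=> e0 ze; apply/(rV_norm_leP _ e0) => j.
have zj k : Normc.normc (z 0 k) <= e.
  have := (rV_norm_leP z (etrans (ler0c e) e0)).1 ze k.
  by rewrite norm_complexE lecR.
rewrite -(splitK j); case: (fintype.split j) => k /=.
  rewrite row_mxEl mxE; apply: le_trans (zj k); case: (z 0 k) => a b /=.
  by rewrite -sqrtr_sqr ler_wsqrtr// lerDl sqr_ge0.
rewrite row_mxEr mxE; apply: le_trans (zj k); case: (z 0 k) => a b /=.
by rewrite -sqrtr_sqr ler_wsqrtr// lerDr sqr_ge0.
Qed.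

Lemma norm_le_to_real (z : 'rV[C]_n) : `|z| <= (2 * `|to_real z|)%:C%C.
Proof.
apply/rV_norm_leP => [|j]; first by rewrite ler0c mulr_ge0.
have t := (rV_norm_leP (to_real z) (normr_ge0 _)).1 (lexx _).
have := t (lshift n j); have := t (rshift n j).
rewrite row_mxEl row_mxEr !mxE norm_complexE lecR; move: `|to_real z| => e.
case: (z 0 j) => a b /=; rewrite !ler_norml => /andP[b1 b2] /andP[a1 a2].
have e0 : 0 <= 2 * e by lra.
by rewrite -(ger0_norm e0) -sqrtr_sqr ler_wsqrtr//; nra.
Qed.

Lemma nbhs_of_real (a : 'rV[C]_n) (A : set 'rV[C]_n) :
  nbhs a A -> nbhs (to_real a) (of_real @^-1` A).
Proof.
move=> /nbhs_ballP[d /= d0 dA].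
have dE := ger0_Re (ltW d0).
have d0' : 0 < complex.Re d by rewrite dE -[0]/(0%:C%C) ltcR in d0.
apply/nbhs_ballP; exists (complex.Re d / 2) => /=; first exact: divr_gt0.
move=> u; rewrite -ball_normE /ball_/= => ua; apply: dA.
rewrite -ball_normE /ball_/= dE; apply: le_lt_trans (norm_le_to_real _) _.
by rewrite ltcR to_realB of_realK; lra.
Qed.

(** For v = p + iq, the real linear form with entries (p, -q) sends the real
    coordinates of z to the real part of z v; it vanishes wherever the complex
    linear form v does. *)
Lemma flat_at_to_real (f : 'rV[C]_n -> 'rV[C]_n) (x : 'rV[C]_n) :
  flat_at f x -> flat_at (to_real \o f \o of_real) (to_real x).
Proof.
move=> [v [v0 [K fK] vP]].
pose v' := col_mx (map_mx (@complex.Re R) v) (- map_mx (@complex.Im R) v).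
have vE (z : 'rV[C]_n) : (to_real z *m v') 0 0 = complex.Re ((z *m v) 0 0).
  rewrite mul_row_col !mxE -big_split /=.
  have Re_sum (I : Type) (r : seq I) (F : I -> C) :
      complex.Re (\sum_(i <- r) F i) = \sum_(i <- r) complex.Re (F i).
    by elim/big_rec2: _ => // i p q _ <-; case: (F i) q => [a b] [c d].
  rewrite Re_sum; apply: eq_bigr => i _; rewrite !mxE.
  by case: (z 0 i) (v i 0) => [a b] [c d] /=; rewrite mulrN.
exists v'; split.
- apply: contra v0 => /eqP v'0; apply/eqP/colP => i.
  have := congr1 (fun w : 'cV_(n + n) => w (lshift n i) 0) v'0.
  have := congr1 (fun w : 'cV_(n + n) => w (rshift n i) 0) v'0.
  rewrite col_mxEu col_mxEd !mxE; case: (v i 0) => [a b] /= /eqP.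
  by rewrite oppr_eq0 => /eqP -> ->.
- exists (2 * Normc.normc K); apply: filterS (nbhs_of_real fK) => u /=.
  rewrite to_realK => uK; rewrite -to_realB; apply: to_real_norm_le.
    by rewrite !mulr_ge0// -ler0c -norm_complexE.
  apply: (le_trans uK).
  (* The constant K need not be real, but its product with the norm is. *)
  rewrite -[leLHS](ger0_norm (le_trans (normr_ge0 _) uK)) normrM normr_id.
  have := norm_le_to_real (of_real u - x); rewrite to_realB of_realK => ux.
  apply: le_trans (ler_wpM2l (normr_ge0 K) ux) _.
  by rewrite norm_complexE -rmorphM lecR mulrCA mulrA.
- move=> e e0.
  have e20 : (0 : C) < (e / 2)%:C%C by rewrite -[0]/(0%:C%C) ltcR divr_gt0.
  apply: filterS (nbhs_of_real (vP _ e20)) => u /=.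
  rewrite to_realK -to_realB vE => uv.
  have {}uv :
      `|((f (of_real u) - f x) *m v) 0 0| <= (e * `|u - to_real x|)%:C%C.
    apply: le_trans uv _.
    have := norm_le_to_real (of_real u - x); rewrite to_realB of_realK => ux.
    apply: le_trans (ler_wpM2l (ltW e20) ux) _.
    by rewrite -rmorphM lecR mulrA divfK.
  move: uv; rewrite norm_complexE lecR; apply: le_trans.
  case: (_ 0 0) => a b /=.
  by rewrite -sqrtr_sqr ler_wsqrtr// lerDl sqr_ge0.
Qed.
End RealCoordinates.

Lemma flat_images_empty_interior_complex (R : realType) (n : nat)
    (f : nat -> 'rV[Num.NumField.sort R[i]]_n -> 'rV[Num.NumField.sort R[i]]_n)
    (E : nat -> set 'rV[Num.NumField.sort R[i]]_n)
    (a : 'rV[Num.NumField.sort R[i]]_n) :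
  (forall k x, E k x -> flat_at (f k) x) -> ~ nbhs a (\bigcup_k f k @` E k).
Proof.
move=> Ef /nbhs_of_real aA.
apply: (@flat_images_empty_interior_real R _
  (fun k => to_real \o f k \o of_real)
  (fun k => to_real @` E k) (to_real a)).
  by move=> k _ [x Ex <-]; apply/flat_at_to_real/Ef.
apply: filterS aA => u /= [k _ [x Ex xu]]; exists k => //.
exists (to_real x); first by exists x.
by rewrite /= to_realK xu of_realK.
Qed.

Theorem flat_images_empty_interior (R : realType) (g : ground) (n : nat)
    (f : nat -> 'rV[ground_field R g]_n -> 'rV[ground_field R g]_n)
    (E : nat -> set 'rV[ground_field R g]_n) (a : 'rV[ground_field R g]_n) :
  (forall k x, E k x -> flat_at (f k) x) -> ~ nbhs a (\bigcup_k f k @` E k).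
Proof.
case: g f E a => f E a.
  exact: flat_images_empty_interior_real.
exact: flat_images_empty_interior_complex.
Qed.

(** * Singular differentials *)

Section Differential.
Context {K : numFieldType} {V W : normedModType K}.
Implicit Types (f g : V -> W) (x : V).

Lemma differentiable_approx f x : differentiable f x -> forall e, 0 < e ->
  \forall y \near x, `|f y - f x - 'd f x (y - x)| <= e * `|y - x|.
Proof.
move=> /diff_locally/eqaddoP fx e e0.
rewrite (near_shift 0 x); apply: filterS (fx _ e0) => h /=.
by rewrite subr0 /= addrK opprD addrA.
Qed.

(** Local functions are represented by total functions whose values away from
    the domain are arbitrary; differentiability has to be transported between
    functions that agree near a point only. *)
Lemma near_eq_differentiable f g x : (\forall y \near x, f y = g y) ->
  differentiable f x -> differentiable g x /\ 'd g x = 'd f x :> (V -> W).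
Proof.
move=> fg fx; have fgx : f x = g x := nbhs_singleton fg.
have gE : g \o shift x = cst (g x) + 'd f x +o_ 0 id.
  have /eqaddoP fo := diff_locally fx; apply/eqaddoP => e e0.
  have fg0 : \forall h \near (0 : V), f (h + x) = g (h + x).
    move: fg; rewrite (near_shift 0 x); apply: filterS => h /=.
    by rewrite subr0.
  apply: filterS2 fg0 (fo _ e0) => h fgh.
  rewrite /= -fgx => fe.
  by rewrite -[X in `|X|]/(g (h + x) - (f x + 'd f x h)) -fgh; exact: fe.
have dE := diff_unique (@diff_continuous _ _ _ _ _ fx) gE.
split => //; apply/diff_locallyP; rewrite dE; split => //.
exact: diff_continuous.
Qed.

End Differential.

(** In the row-vector convention ['d f x h = h *m J], a column v in the kernel
    of the Jacobian matrix J is a linear form that vanishes on the image of the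
    differential. *)
Lemma flat_at_singular_jacobian (K : numFieldType) (n : nat)
    (f : 'rV[K]_n -> 'rV[K]_n) (x : 'rV[K]_n) :
  differentiable f x -> jacobian f x \notin unitmx -> flat_at f x.
Proof.
move=> fx Jx.
have [v v0 Jv] : exists2 v : 'cV[K]_n, v != 0 & jacobian f x *m v = 0.
  have : \det (jacobian f x)^T == 0.
    by rewrite det_tr -[_ == 0]negbK -unitfE -unitmxE.
  move=> /det0P[w w0 wJ]; exists w^T; first by rewrite trmx_eq0.
  by apply: trmx_inj; rewrite trmx_mul trmxK wJ trmx0.
have approx := differentiable_approx fx.
exists v; split => //.
- have [k k0 kP] := linear_lipschitz (@diff_continuous _ _ _ _ _ fx).
  exists (1 + k); apply: filterS (approx _ ltr01) => y yx.
  rewrite -[f y - f x](subrK ('d f x (y - x))) mulrDl.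
  by apply: le_trans (ler_normD _ _) _; rewrite lerD.
- move=> e e0; pose c : K := \sum_j `|v j 0| + 1.
  have c0 : 0 < c by rewrite ltr_wpDl// sumr_ge0.
  have := approx _ (divr_gt0 e0 c0); apply: filterS => y yx.
  have dv : 'd f x (y - x) *m v = 0.
    by rewrite -(mul_rV_lin1 ('d f x)) -mulmxA -/(jacobian f x) Jv mulmx0.
  have -> : (f y - f x) *m v = (f y - f x - 'd f x (y - x)) *m v.
    by rewrite [RHS]mulmxBl dv subr0.
  move: yx; set w := _ - 'd _ _ _ => yx.
  apply: (@le_trans _ _ (`|w| * c)); last first.
    by rewrite -ler_pdivlMr// mulrAC.
  rewrite mxE; apply: le_trans (ler_norm_sum _ _ _) _.
  rewrite /c mulrDr mulr1 mulr_sumr.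
  apply: (@le_trans _ _ (\sum_j `|w| * `|v j 0|)).
    apply: ler_sum => j _; rewrite normrM ler_wpM2r//.
    exact: (rV_norm_leP w (normr_ge0 _)).1.
  by rewrite lerDl.
Qed.

(** * Coordinates of differentiable maps *)

Section Jacobian.
Context {K : numFieldType}.

Lemma det_continuous n : continuous (fun A : 'M[K]_n => \det A : K).
Proof.
move=> A; apply: (@cvg_big K _ _ _ _ _ _ (nbhs A)) => [|s _].
  exact: add_continuous.
apply: (@cvgM _ _ (nbhs A)); first exact: cvg_cst.
apply: (@cvg_big K _ _ _ _ _ _ (nbhs A)) => [|i _]; first exact: mul_continuous.
exact: coord_continuous.
Qed.

Section Coord.
Variables (n : nat) (j : 'I_n).
(** The values are taken in [K^o], so that this is a linear map between normed
    modules. *)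
Definition coord_row (x : 'rV[K]_n) : K^o := x 0 j.

Fact coord_row_linear : linear coord_row.
Proof. by move=> a x y; rewrite /coord_row !mxE. Qed.

HB.instance Definition _ :=
  GRing.isLinear.Build K 'rV[K]_n K^o _ coord_row coord_row_linear.

Lemma is_diff_coord_row x : is_diff x coord_row coord_row.
Proof.
have c : continuous coord_row by exact: coord_continuous.
by apply: DiffDef; [exact: linear_differentiable|rewrite diff_lin].
Qed.
End Coord.

Lemma differentiable_coord_comp (V : normedModType K) n (f : V -> 'rV[K]_n)
    x j :
  differentiable f x -> differentiable (@coord_row n j \o f) x.
Proof.
move=> fx; apply: differentiable_comp => //.
by have [] := is_diff_coord_row j (f x).
Qed.

Lemma derive_coord_comp (V : normedModType K) n (f : V -> 'rV[K]_n) x v j :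
  differentiable f x -> 'D_v (@coord_row n j \o f) x = 'D_v f x 0 j.
Proof.
move=> fx; have [dc cE] := is_diff_coord_row j (f x).
rewrite !deriveE//; last exact: differentiable_coord_comp.
by rewrite diff_comp// cE.
Qed.

Lemma jacobian_comp m n p (f : 'rV[K]_m -> 'rV[K]_n)
    (g : 'rV[K]_n -> 'rV[K]_p) x :
  differentiable f x -> differentiable g (f x) ->
  jacobian (g \o f) x = jacobian f x *m jacobian g (f x).
Proof.
move=> fx gx; apply/row_matrixP => i.
by rewrite !rowE mulmxA !mul_rV_lin1 diff_comp.
Qed.

Lemma near_eq_jacobian m n (f g : 'rV[K]_m -> 'rV[K]_n) x :
  (\forall y \near x, f y = g y) -> differentiable f x ->
  jacobian g x = jacobian f x.
Proof.
move=> fg fx; have [_ dE] := near_eq_differentiable fg fx.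
apply/row_matrixP => i.
rewrite [LHS]rowE [RHS]rowE.
rewrite [LHS]mul_rV_lin1 [RHS]mul_rV_lin1.
exact: (congr1 (fun h => h (delta_mx 0 i)) dE).
Qed.

(** The function h is only required to be a coordinate of f on U, because
    partial derivatives of f and of its coordinate need not correspond at points
    where f is not differentiable; the induction therefore needs this form. *)
Lemma class_C_coord m n k (U : set 'rV[K]_m) (f : 'rV[K]_m -> 'rV[K]_n)
    (h : 'rV[K]_m -> K^o) j :
  open U -> (forall x, U x -> h x = f x 0 j) -> class_C k U f -> class_C k U h.
Proof.
move=> oU; elim: k f h => [|k IH] f h hf /=.
  move=> fU x Ux; have fx := fU x Ux.
  have hfx : \forall y \near x, coord_row j (f y) = h y.
    by apply: filterS (open_nbhs_nbhs (conj oU Ux)) => y /hf ->.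
  rewrite /prop_for /continuous_at (hf x Ux).
  apply: (cvg_trans (near_eq_cvg hfx)).
  apply: (@continuous_comp _ _ _ f (@coord_row n j)) fx _.
  exact: coord_continuous.
move=> [df Df].
have hdf x : U x -> differentiable h x /\ forall v, 'D_v h x = 'D_v f x 0 j.
  move=> Ux; have dfx := df x Ux.
  have hfx : \forall y \near x, (@coord_row n j \o f) y = h y.
    by apply: filterS (open_nbhs_nbhs (conj oU Ux)) => y /hf ->.
  have [dh _] := near_eq_differentiable hfx (differentiable_coord_comp j dfx).
  split => // v; rewrite -derive_coord_comp//.
  by apply: near_eq_derive; apply: filterS hfx => y ->.
split => [x /hdf[]//|i].
apply: IH (Df i) => x Ux.
by have [_ ->] := hdf x Ux.
Qed.
End Jacobian.

(** * Regular maps and charts *)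

Section Regularity.
Context {R : realType} {g : ground}.
Local Notation K := (ground_field R g).

Lemma regular_differentiable m (V : normedModType K) (U : set 'rV[K]_m)
    (f : 'rV[K]_m -> V) :
  regular R g _ _ U f -> forall x, U x -> differentiable f x.
Proof. by case: g V U f => V U f //= fU; have [] := fU 1%N. Qed.

Lemma regular_coord m n (U : set 'rV[K]_m) (f : 'rV[K]_m -> 'rV[K]_n)
    (h : 'rV[K]_m -> K^o) j :
  open U -> (forall x, U x -> h x = f x 0 j) ->
  regular R g _ _ U f -> regular R g _ _ U h.
Proof.
case: g U f h => U f h oU hf /= fU.
  by move=> k; apply: (class_C_coord oU hf (fU k)).
move=> x Ux.
have hfx : \forall y \near x, (@coord_row _ n j \o f) y = h y.
  by apply: filterS (open_nbhs_nbhs (conj oU Ux)) => y /hf ->.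
have dfx := differentiable_coord_comp j (fU x Ux).
by have [] := near_eq_differentiable hfx dfx.
Qed.
End Regularity.

Section Charts.
Context {K : numFieldType} {n : nat} {T : topologicalType}.
Implicit Types c : chart (K := K) n T.

Lemma chart_inv_dom c z : (chart_map c @` dom c) z ->
  dom c (chart_inv c z) /\ chart_map c (chart_inv c z) = z.
Proof. by move=> [x cx <-]; rewrite chart_mapK. Qed.

Lemma chart_inv_near c (A : set T) x :
  dom c x -> nbhs x A -> \forall z \near chart_map c x,
    [/\ (chart_map c @` dom c) z, dom c (chart_inv c z) & A (chart_inv c z)].
Proof.
move=> cx xA.
have := @chart_inv_continuous _ _ _ c.
rewrite continuous_open_subspace; last exact: chart_image_open.
have zc : (chart_map c @` dom c) (chart_map c x) by exists x.
move=> /(_ (chart_map c x)); rewrite inE => /(_ zc) ci.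
have xA' : nbhs (chart_inv c (chart_map c x)) A by rewrite chart_mapK.
have zI := open_nbhs_nbhs (conj (@chart_image_open _ _ _ c) zc).
have ciA := ci _ xA'; apply: filterS2 zI ciA => z cz Az.
by split => //; case: (chart_inv_dom cz).
Qed.

Lemma chart_map_near c x (A : set 'rV[K]_n) :
  dom c x -> nbhs (chart_map c x) A -> \forall y \near x, A (chart_map c y).
Proof.
move=> cx; have := @chart_map_continuous _ _ _ c.
rewrite continuous_open_subspace; last exact: dom_open.
by move=> /(_ x); rewrite inE => /(_ cx) cm xA; exact: cm _ xA.
Qed.

Lemma nbhs_chart_map c x (A : set T) :
  dom c x -> nbhs x A -> nbhs (chart_map c x) (chart_map c @` (dom c `&` A)).
Proof.
move=> cx xA; apply: filterS (chart_inv_near cx xA) => z [cz dz Az].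
by exists (chart_inv c z) => //; case: (chart_inv_dom cz).
Qed.

Lemma open_chart_map c (A : set T) :
  open A -> open (chart_map c @` (dom c `&` A)).
Proof.
move=> oA; rewrite openE => _ [x [cx Ax] <-].
by apply: nbhs_chart_map => //; apply: open_nbhs_nbhs.
Qed.
End Charts.

(** * Bivector fields and Poisson morphisms *)

(** The gradients of the coordinates of psi are the columns of J. *)
Lemma bracket_of_coords (K : numFieldType) (reg : regularity K) (n m : nat)
    (M : manifold reg n) (B : chart (K := K) n M -> M -> 'M[K]_n)
    (psi : M -> 'rV[K]_m) (x : M) (i j : 'I_m) :
  let c := chart_at x in
  differentiable (psi \o chart_inv c) (chart_map c x) ->
  let J := jacobian (psi \o chart_inv c) (chart_map c x) in
  bracket_of B (fun y => psi y 0 i) (fun y => psi y 0 j) x =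
    (J^T *m B c x *m J) i j.
Proof.
move=> c dpsi J.
have pE k a : partial (chart_at x) a (fun y => psi y 0 k) x = J a k.
  rewrite /partial (@derive_coord_comp _ _ _ (psi \o chart_inv c) _ _ k)//.
  by rewrite deriveEjacobian// -rowE mxE.
rewrite /bracket_of mxE exchange_big /=; apply: eq_bigr => b _.
rewrite mxE big_distrl /=; apply: eq_bigr => a _.
by rewrite !pE !mxE; ring.
Qed.

(** Take a locally finite refinement of the covering by chart domains. Each of
    its nonempty members meets a countable dense set, and each point of this
    set lies in finitely many members; so there are countably many. *)
Lemma charts_cover_countable (K : numFieldType) (reg : regularity K) (n : nat)
    (M : manifold reg n) (x0 : M) : separable_space M ->
  exists p : nat -> M, forall x, exists k, dom (chart_at (p k)) x.
Proof.
move=> [Q cQ dQ].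
pose cover_by_charts := [set dom (chart_at x) | x in [set: M]].
have [| |D [oD cD rD lD]] := @points_paracompact _ _ _ M cover_by_charts.
- by move=> _ [x _ <-]; exact: dom_open.
- apply/seteqP; split => // x _; exists (dom (chart_at x)); first by exists x.
  exact: chart_at_dom.
have cDne : countable [set B | D B /\ B !=set0].
  apply: (@sub_countable _ _ _ (\bigcup_(q in Q) [set B | D B /\ B q])).
    apply: subset_card_le => B [DB B0].
    by have [q [Bq Qq]] := dQ B B0 (oD B DB); exists q.
  apply: bigcup_countable => // q Qq; apply: finite_set_countable.
  have [W qW fW] := lD q; apply: sub_finite_set fW => B [DB Bq]; split => //.
  by exists q; split => //; exact: nbhs_singleton.
have /countable_injP[f finj] := cDne.
have /choice[p pP] k : exists p : M, forall B, D B -> B !=set0 -> f B = k ->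
    B `<=` dom (chart_at p).
  have [[B [DB B0] fB]|nB] := pselect (exists2 B, D B /\ B !=set0 & f B = k).
    have [_ [p _ <-] Bp] := rD B DB; exists p => B' DB' B'0 fB'.
    by have -> : B' = B; [apply: finj; rewrite ?inE ?fB' ?fB|].
  by exists x0 => B DB B0 fB; exfalso; apply: nB; exists B.
exists p => x; have : [set: M] x by [].
rewrite -cD => -[B DB Bx]; exists (f B); apply: (pP (f B) B DB) => //.
by exists x.
Qed.

Section Poisson.
Context {R : realType} {g : ground} {n : nat}.
Local Notation K := (ground_field R g).
Local Notation poisson := (poisson_manifold (regular R g) n).
Implicit Types M P : poisson.

Lemma regular_fun_coord (M : manifold (regular R g) n)
    (d : chart (K := K) n M) j :
  atlas d -> regular_fun (dom d) (fun y : M => chart_map d y 0 j).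
Proof.
move=> ad c ac; have := atlas_compatible ac ad; apply: regular_coord => //.
by apply: open_chart_map; exact: dom_open.
Qed.

(** From [bivector d x = J^T *m bivector c x *m J], the left-hand side can only
    be invertible if every factor is. *)
Lemma unitmx_bivector_change M (c d : chart (K := K) n M) (x : M) :
  atlas c -> atlas d -> dom c x -> dom d x ->
  bivector d x \in unitmx -> bivector c x \in unitmx.
Proof.
move=> ac ad cx dx; rewrite (bivector_change ac ad cx dx).
by rewrite !unitmx_mul => /andP[/andP[]].
Qed.

Lemma transition_differentiable (M : manifold (regular R g) n)
    (c d : chart (K := K) n M) (x : M) :
  atlas c -> atlas d -> dom c x -> dom d x ->
  differentiable (chart_map d \o chart_inv c) (chart_map c x).
Proof.
move=> ac ad cx dx; apply: (regular_differentiable (atlas_compatible ac ad)).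
by exists x.
Qed.

Lemma regular_map_differentiable (N M : manifold (regular R g) n) (phi : N -> M)
    (c : chart (K := K) n N) (d : chart (K := K) n M) (x : N) :
  regular_map phi -> atlas c -> atlas d -> dom c x -> dom d (phi x) ->
  differentiable (chart_map d \o phi \o chart_inv c) (chart_map c x).
Proof.
move=> [_ rphi] ac ad cx dx.
by apply: (regular_differentiable (rphi c d ac ad)); exists x.
Qed.

(** Apply the Poisson condition to the coordinate functions of the chart d: the
    bracket of two of them on the target is an entry of [bivector d], and the
    bracket of their pullbacks is an entry of the right-hand side. *)
Lemma poisson_morphism_bivector P M (phi : P -> M) (c : chart (K := K) n P)
    (d : chart (K := K) n M) (x : P) :
  poisson_morphism phi -> atlas c -> atlas d -> dom c x -> dom d (phi x) ->
  let J := jacobian (chart_map d \o phi \o chart_inv c) (chart_map c x) in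
  bivector d (phi x) = J^T *m bivector c x *m J.
Proof.
move=> [rphi brphi] ac ad cx dx.
have a0 := chart_at_atlas x; have x0 := chart_at_dom x.
(* The bracket of the source is evaluated in the chart at x, hence the identity
   is first obtained for that chart. *)
have -> : let J := jacobian (chart_map d \o phi \o chart_inv (chart_at x))
            (chart_map (chart_at x) x) in
    bivector d (phi x) = J^T *m bivector (chart_at x) x *m J.
  move=> J; apply/matrixP => i j.
  have := brphi _ _ _ (@dom_open _ _ _ d) (regular_fun_coord i ad)
    (regular_fun_coord j ad) x dx.
  have ay := chart_at_atlas (phi x); have yy := chart_at_dom (phi x).
  rewrite /bracket (bracket_of_coords _ _ _ (psi := chart_map d \o phi)).
    2: exact: regular_map_differentiable.
  rewrite (bracket_of_coords _ _ _ (psi := chart_map d)).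
    2: exact: transition_differentiable.
  rewrite -(bivector_change ay ad yy dx).
  by move=> <-.
rewrite /= (bivector_change a0 ac x0 cx).
set f := chart_map d \o phi \o chart_inv c.
set t := chart_map c \o chart_inv (chart_at x).
have tx : t (chart_map (chart_at x) x) = chart_map c x.
  by rewrite /t /= chart_mapK.
have dt : differentiable t (chart_map (chart_at x) x).
  exact: transition_differentiable.
have df : differentiable f (t (chart_map (chart_at x) x)).
  by rewrite tx; exact: regular_map_differentiable.
rewrite (@near_eq_jacobian _ _ _ (f \o t)).
- by rewrite jacobian_comp// tx trmx_mul !mulmxA.
- have xc : nbhs x (dom c).
    by apply: open_nbhs_nbhs; split => //; exact: dom_open.
  apply: filterS (chart_inv_near x0 xc) => z [_ _ cz].
  by rewrite /f /t /= chart_mapK.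
- exact: differentiable_comp.
Qed.

(** Membership is tested in the chart chosen at each point; by
    [unitmx_bivector_change] any other chart would do. *)
Definition nondegenerate_locus M : set M :=
  [set x | bivector (chart_at x) x \in unitmx].
Arguments nondegenerate_locus : clear implicits.

Lemma nondegenerate_locus_open M : open (nondegenerate_locus M).
Proof.
rewrite openE => x xU; set c := chart_at x.
have ac : atlas c := chart_at_atlas x; have cx : dom c x := chart_at_dom x.
have hx : {for chart_map c x, continuous (bivector c \o chart_inv c)}.
  apply: differentiable_continuous.
  apply: (regular_differentiable (bivector_regular ac)).
  by exists x.
have detx :
    \forall z \near chart_map c x, \det (bivector c (chart_inv c z)) != 0.
  have cdet : {for chart_map c x,
      continuous (fun z => \det ((bivector c \o chart_inv c) z))}.
    by apply: continuous_comp hx _; exact: det_continuous.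
  apply: (cvgr_neq0 _ cdet).
  by rewrite /= chart_mapK// -unitfE -unitmxE.
have xc : nbhs x (dom c).
  by apply: open_nbhs_nbhs; split => //; exact: dom_open.
apply: filterS2 xc (chart_map_near cx detx) => y cy.
rewrite chart_mapK// => dety.
have ay := chart_at_atlas y; have yy := chart_at_dom y.
apply: (@unitmx_bivector_change M _ c) => //.
by rewrite unitmxE unitfE.
Qed.

Lemma symplectic_on_nondegenerate_locus M :
  symplectic_on (nondegenerate_locus M).
Proof.
move=> x xU c ac cx; have ax := chart_at_atlas x; have xx := chart_at_dom x.
exact: (@unitmx_bivector_change M _ (chart_at x)).
Qed.

(** If V is open, nonempty and misses the locus, then phi is critical at all
    points above V. In a chart d around a point of V, the image of V is then
    the union, over countably many charts of the source, of images of sets of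
    flat points. *)
Lemma nondegenerate_locus_dense M (S : symplectic_resolution M) :
  separable_space (source S) -> dense (nondegenerate_locus M).
Proof.
move=> sep V [m0 Vm0] oV; apply: contrapT => VU.
have [x0 _ x0m] := resolution_map_surjective S (I : [set: M] m0).
have [p pP] := charts_cover_countable x0 sep.
pose d := chart_at m0; have ad : atlas d := chart_at_atlas m0.
have [rphi _] := resolution_map_poisson S.
pose phi : source S -> M := @resolution_map _ _ _ _ S.
pose c k := chart_at (p k).
pose f k := chart_map d \o phi \o chart_inv (c k).
pose E k := chart_map (c k) @`
  [set x | [/\ dom (c k) x, V (phi x) & dom d (phi x)]].
apply: (@flat_images_empty_interior R g n f E (chart_map d m0)).
  move=> k _ [x [cx Vx dx] <-].
  have ac : atlas (c k) := chart_at_atlas (p k).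
  apply: flat_at_singular_jacobian.
    exact: regular_map_differentiable.
  apply/negP => Ju; apply: VU; exists (phi x); split => //.
  have ay := chart_at_atlas (phi x); have yy := chart_at_dom (phi x).
  apply: (@unitmx_bivector_change M _ d) => //.
  rewrite (poisson_morphism_bivector (resolution_map_poisson S) ac ad cx dx).
  rewrite !unitmx_mul unitmx_tr Ju andbT /=.
  exact: (source_symplectic I ac cx).
have := nbhs_chart_map (chart_at_dom m0) (open_nbhs_nbhs (conj oV Vm0)).
apply: filterS => _ [m [dm Vm] <-].
have [x _ xm] := resolution_map_surjective S (I : [set: M] m).
have [k kx] := pP x; exists k => //; exists (chart_map (c k) x).
  by exists x => //; split => //; rewrite /phi xm.
by rewrite /f /= chart_mapK// /phi xm.
Qed.

End Poisson.

Theorem proposition2 (R : realType) (g : ground) (n : nat)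
    (M : poisson_manifold (regular R g) n) (S : symplectic_resolution M) :
  separable_space (source S) ->
  exists U : set M, [/\ open U, dense U & symplectic_on U].
Proof.
move=> sep; exists (@nondegenerate_locus R g n M); split.
- exact: nondegenerate_locus_open.
- exact: nondegenerate_locus_dense sep.
- exact: symplectic_on_nondegenerate_locus.
Qed.
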